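(* Let $L,\Lambda,D>0$ and suppose $F:\mathbb R^n\to\mathbb R^n$ is a monotone operator that is $L$-Lipschitz and has $\Lambda$-Lipschitz derivative. Fix $\mathbf z^{(0)}\in\mathbb R^n$ and suppose there is $\mathbf z^*\in\mathbb R^n$ with $F(\mathbf z^* )=0$ and $\|\mathbf z^*-\mathbf z^{(0)}\|\le D$. Let $0<\eta\le\min\left\{\frac{5}{\Lambda D},\frac1{30L}\right\}$ and let $\mathbf z^{(t)}$ be the iterates of the extragradient algorithm with step size $\eta$ initialized at $\mathbf z^{(0)}$. Then for all $T\in\mathbb N$, $T\ge1$, $$\|F(\mathbf z^{(T)})\|\le\frac{2D}{\eta\sqrt T}.$$ If moreover $F(\mathbf x,\mathbf y)=\begin{pmatrix}\nabla_{\mathbf x}f(\mathbf x,\mathbf y)\\-\nabla_{\mathbf y}f(\mathbf x,\mathbf y)\end{pmatrix}$ for a convex-concave function $f:\mathbb R^{n_{\mathbf x}}\times\mathbb R^{n_{\mathbf y}}\to\mathbb R$ with $n_{\mathbf x}+n_{\mathbf y}=n$, then, writing $\mathbf z^*=(\mathbf x^*,\mathbf y^* )$ and $\mathbf z^{(T)}=(\mathbf x^{(T)},\mathbf y^{(T)})$, $$\max_{\mathbf y'\in\mathcal B(\mathbf y^*,D)}f(\mathbf x^{(T)},\mathbf y')-\min_{\mathbf x'\in\mathcal B(\mathbf x^*,D)}f(\mathbf x',\mathbf y^{(T)})\le\frac{2\sqrt2\,D^2}{\eta\sqrt T}$$ for all $T\in\mathbb N$, $T\ge1$.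
   Context: $\|\cdot\|$ is the Euclidean norm on vectors and $\|\cdot\|_\sigma$ the spectral norm (largest singular value) on matrices; $\mathcal B(\mathbf z,D)$ is the Euclidean ball with center $\mathbf z$ and radius $D$. $F$ is monotone if $\langle F(\mathbf z)-F(\mathbf z'),\mathbf z-\mathbf z'\rangle\ge0$ for all $\mathbf z,\mathbf z'$. $F$ is $L$-Lipschitz if $\|F(\mathbf z)-F(\mathbf z')\|\le L\|\mathbf z-\mathbf z'\|$ for all $\mathbf z,\mathbf z'$. $F$ has $\Lambda$-Lipschitz derivative if it is differentiable with Jacobian $\partial F$, $(\partial F)_{i,j}=\partial F_i/\partial\mathbf z_j$, satisfying $\|\partial F(\mathbf z)-\partial F(\mathbf z')\|_\sigma\le\Lambda\|\mathbf z-\mathbf z'\|$ for all $\mathbf z,\mathbf z'$. A function $f(\mathbf x,\mathbf y)$ is convex-concave if it is convex in $\mathbf x$ for each fixed $\mathbf y$ and concave in $\mathbf y$ for each fixed $\mathbf x$; $f$ is assumed twice differentiable. The extragradient algorithm with step size $\eta$ has iterates, for $t\ge0$: $\mathbf z^{(t+1/2)}=\mathbf z^{(t)}-\eta F(\mathbf z^{(t)})$, $\ \mathbf z^{(t+1)}=\mathbf z^{(t)}-\eta F(\mathbf z^{(t+1/2)})$. *)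

(* Defs.v *)
From HB Require Import structures.
From mathcomp Require Import all_boot all_order all_algebra.
From mathcomp Require Import all_classical all_reals all_analysis.
Import Order.TTheory GRing.Theory Num.Theory.
Import numFieldNormedType.Exports.

Set Implicit Arguments.
Unset Strict Implicit.
Unset Printing Implicit Defensive.

Local Open Scope classical_set_scope.
Local Open Scope ring_scope.

(* Points of R^n are row vectors, for which the library provides Jacobians.   *)
(* The library norm `|v| on 'rV[R]_n is the max norm; it is used here only    *)
(* through differentiability, which is the same for all norms on R^n.         *)

Section euclidean.
Context {R : realType}.

Definition dotv n (u v : 'rV[R]_n) : R := \sum_(i < n) u 0 i * v 0 i.

Definition enorm n (v : 'rV[R]_n) : R := Num.sqrt (dotv v v).

Definition eball n (c : 'rV[R]_n) (r : R) : set 'rV[R]_n :=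
  [set z | enorm (z - c) <= r].

Definition singular_values m n (A : 'M[R]_(m, n)) : set R :=
  [set Num.sqrt a | a in [set a | eigenvalue (A^T *m A) a]].

(* [singular_values A] is finite, so [sup] is its largest element; it is      *)
(* empty only for n = 0, in which case [sup] is 0.                            *)
Definition spectral_norm m n (A : 'M[R]_(m, n)) : R := sup (singular_values A).

End euclidean.

Section operators.
Context {R : realType}.

(* ['J F z] acts on row vectors from the right, so its (i, j) entry is        *)
(* dF_j/dz_i; the transpose has dF_i/dz_j there.                              *)
Definition jac n m (F : 'rV[R]_n -> 'rV[R]_m) (z : 'rV[R]_n) : 'M[R]_(m, n) :=
  ('J F z)^T.

Definition monotone_op n (F : 'rV[R]_n -> 'rV[R]_n) : Prop :=
  forall z z', 0 <= dotv (F z - F z') (z - z').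

Definition lipschitz_op n (L : R) (F : 'rV[R]_n -> 'rV[R]_n) : Prop :=
  forall z z', enorm (F z - F z') <= L * enorm (z - z').

Definition lipschitz_derivative n (Lam : R) (F : 'rV[R]_n -> 'rV[R]_n) : Prop :=
  (forall z, differentiable F z) /\
  (forall z z', spectral_norm (jac F z - jac F z') <= Lam * enorm (z - z')).

Definition eg_step n (eta : R) (F : 'rV[R]_n -> 'rV[R]_n) (z : 'rV[R]_n) :=
  let zhalf := z - eta *: F z in z - eta *: F zhalf.

Definition extragradient n (eta : R) (F : 'rV[R]_n -> 'rV[R]_n)
    (z0 : 'rV[R]_n) (t : nat) : 'rV[R]_n :=
  iter t (eg_step eta F) z0.

End operators.

Section saddle.
Context {R : realType}.

Definition grad n (g : 'rV[R]_n -> R) (z : 'rV[R]_n) : 'rV[R]_n :=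
  \row_(i < n) 'D_(delta_mx 0 i) g z.

(* For finite-dimensional V, the derivative q |-> Df(q) is differentiable     *)
(* iff q |-> Df(q) v is for every direction v.                                *)
Definition twice_differentiable (V : normedModType R) (f : V -> R) : Prop :=
  (forall p, differentiable f p) /\
  (forall v p, differentiable (fun q => 'D_v f q) p).

Definition convex_concave nx ny (f : 'rV[R]_nx * 'rV[R]_ny -> R) : Prop :=
  (forall y, convex_function [set: convex_lmodType 'rV[R]_nx]
    (fun x => f (x, y))) /\
  (forall x, convex_function [set: convex_lmodType 'rV[R]_ny]
    (fun y => - f (x, y))).

(* Identification of R^nx x R^ny with R^n along nx + ny = n. *)
Definition joinv nx ny n (e : (nx + ny)%N = n)
    (x : 'rV[R]_nx) (y : 'rV[R]_ny) : 'rV[R]_n :=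
  castmx (erefl 1%N, e) (row_mx x y).

Definition xpart nx ny n (e : (nx + ny)%N = n) (z : 'rV[R]_n) : 'rV[R]_nx :=
  lsubmx (castmx (erefl 1%N, esym e) z).

Definition ypart nx ny n (e : (nx + ny)%N = n) (z : 'rV[R]_n) : 'rV[R]_ny :=
  rsubmx (castmx (erefl 1%N, esym e) z).

Definition saddle_operator nx ny n (e : (nx + ny)%N = n)
    (f : 'rV[R]_nx * 'rV[R]_ny -> R) (F : 'rV[R]_n -> 'rV[R]_n) : Prop :=
  forall x y, F (joinv e x y) =
    joinv e (grad (fun x' => f (x', y)) x) (- grad (fun y' => f (x, y')) y).

Definition is_maximum (A : set R) (M : R) : Prop := A M /\ ubound A M.

Definition is_minimum (A : set R) (m : R) : Prop := A m /\ lbound A m.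

End saddle.

(* Main.v *)
(* Write a = F z, b = F (z - eta a), c = F (z - eta b) for one step from z.
   Monotonicity between z and z - eta b, together with the Lipschitz bound
   between z - eta a and z - eta b, gives |c| <= |a|: the residual |F(z^(t))|
   never increases.  Monotonicity between z - eta a and z* makes the squared
   distance to z* decrease by at least eta^2 (1 - (eta L)^2) |a|^2.  Hence
     |z^(T) - z*|^2 + T eta^2 (1 - (eta L)^2) |F(z^(T))|^2
   is at most |z^(0) - z*|^2, which yields the rate.  The duality gap is at most
   <F(z^(T)), z^(T) - z'> with z' = (x', y') the extremal points of the two balls,
   and |z^(T) - z*| <= D, |z* - z'| <= sqrt 2 D. *)
Require Import Defs.
From mathcomp Require Import all_boot all_order all_algebra.
From mathcomp Require Import all_classical all_reals all_analysis.
From mathcomp Require Import ring lra.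
Import Order.TTheory GRing.Theory Num.Theory.
Import numFieldNormedType.Exports.

Set Implicit Arguments.
Unset Strict Implicit.
Unset Printing Implicit Defensive.

Local Open Scope classical_set_scope.
Local Open Scope ring_scope.

(** * Euclidean geometry of row vectors, and compactness of Euclidean balls *)

Section euclidean_space.
Context {R : realType} {n : nat}.
Implicit Types (u v w : 'rV[R]_n) (k : R).

Lemma dotvC u v : dotv u v = dotv v u.
Proof. by apply: eq_bigr => i _; rewrite mulrC. Qed.

Lemma dotvDl u v w : dotv (u + v) w = dotv u w + dotv v w.
Proof. by rewrite /dotv -big_split; apply: eq_bigr => i _; rewrite mxE mulrDl. Qed.

Lemma dotvZl k u v : dotv (k *: u) v = k * dotv u v.
Proof. by rewrite /dotv mulr_sumr; apply: eq_bigr => i _; rewrite mxE mulrA. Qed.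

Lemma dotvNl u v : dotv (- u) v = - dotv u v.
Proof. by rewrite -scaleN1r dotvZl mulN1r. Qed.

Lemma dotvDr u v w : dotv u (v + w) = dotv u v + dotv u w.
Proof. by rewrite !(dotvC u) dotvDl. Qed.

Lemma dotvZr k u v : dotv u (k *: v) = k * dotv u v.
Proof. by rewrite !(dotvC u) dotvZl. Qed.

Lemma dotvNr u v : dotv u (- v) = - dotv u v.
Proof. by rewrite !(dotvC u) dotvNl. Qed.

Definition dotv_bilin := (dotvDl, dotvDr, dotvNl, dotvNr, dotvZl, dotvZr).

Lemma dotvv_ge0 u : 0 <= dotv u u.
Proof. by apply: sumr_ge0 => i _; rewrite -expr2 sqr_ge0. Qed.

Lemma dotvv_eq0 u : dotv u u = 0 -> u = 0.
Proof.
move/eqP; rewrite /dotv psumr_eq0 => [/allP u0|i _]; last by rewrite -expr2 sqr_ge0.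
apply/rowP => i; rewrite mxE; apply/eqP.
by have := u0 i (mem_index_enum i); rewrite /= mulf_eq0 orbb.
Qed.

Lemma enorm_ge0 u : 0 <= enorm u.
Proof. exact: sqrtr_ge0. Qed.

Lemma sqr_enorm u : enorm u ^+ 2 = dotv u u.
Proof. by rewrite sqr_sqrtr// dotvv_ge0. Qed.

Lemma enorm_le u k : 0 <= k -> (enorm u <= k) = (dotv u u <= k ^+ 2).
Proof. by move=> k0; rewrite -sqr_enorm ler_pXn2r// nnegrE enorm_ge0. Qed.

Lemma enormBC u v : enorm (u - v) = enorm (v - u).
Proof. by rewrite /enorm -(opprB u v) dotvNl dotvNr opprK. Qed.

(** Cauchy-Schwarz without division: |v|^2 u - <u,v> v has squared norm |v|^2 (|u|^2 |v|^2 -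
    <u,v>^2), and the factor |v|^2 cancels once v = 0 is set aside. *)
Lemma dotv_le_enorm u v : dotv u v <= enorm u * enorm v.
Proof.
have [v0|vN0] := eqVneq (dotv v v) 0.
  by rewrite (dotvv_eq0 v0) -(scale0r 0) dotvZr mul0r mulr_ge0 ?enorm_ge0.
have vgt0 : 0 < dotv v v by rewrite lt_neqAle eq_sym vN0 dotvv_ge0.
have := dotvv_ge0 (dotv v v *: u - dotv u v *: v).
rewrite !dotv_bilin (dotvC v u) => cs.
have : 0 <= dotv v v * (dotv u u * dotv v v - dotv u v ^+ 2) by lra.
rewrite pmulr_rge0// subr_ge0 -!sqr_enorm -exprMn => {}cs.
apply: le_trans (ler_norm _) _.
by rewrite -(@ler_pXn2r _ 2)// ?nnegrE ?mulr_ge0 ?enorm_ge0// real_normK ?num_real.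
Qed.

Lemma continuous_enormB (c : 'rV[R]_n) : continuous (fun z : 'rV[R]_n => enorm (z - c)).
Proof.
have coord i : continuous (fun z : 'rV[R]_n => (z - c) 0 i).
  have -> : (fun z : 'rV[R]_n => (z - c) 0 i) = (fun z => z 0 i - c 0 i).
    by apply/funext => z; rewrite !mxE.
  move=> z; apply: (@continuousB _ _ _ (fun z : 'rV[R]_n => z 0 i) (fun=> c 0 i)).
    exact: coord_continuous.
  exact: cst_continuous.
have dot : continuous (fun z : 'rV[R]_n => dotv (z - c) (z - c)).
  apply: continuous_big => [|i _ z]; first exact: add_continuous.
  by apply: (@continuousM _ _ (fun z : 'rV[R]_n => (z - c) 0 i)); exact: coord.
move=> z; apply: (@continuous_comp _ _ _ (fun z : 'rV[R]_n => dotv (z - c) (z - c))).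
  exact: dot.
exact: sqrt_continuous.
Qed.

(** Boundedness refers to the max norm; this comparison transfers it to Euclidean balls. *)
Lemma mx_norm_le_enorm u : `|u| <= enorm u.
Proof.
rewrite [leLHS]/Num.norm/= mx_normrE; apply/bigmax_leP; split=> [|[i j] _ /=].
  exact: enorm_ge0.
rewrite ord1 -(@ler_pXn2r _ 2)// ?nnegrE ?enorm_ge0// sqr_enorm real_normK ?num_real//.
rewrite /dotv (bigD1 j)//= -expr2 lerDl.
by apply: sumr_ge0 => k _; rewrite -expr2 sqr_ge0.
Qed.

Lemma compact_eball (c : 'rV[R]_n) (r : R) : compact (eball c r).
Proof.
apply: bounded_closed_compact.
  exists (`|c| + r); split; first exact: num_real.
  move=> M ltM z /= zcr; apply: le_trans (ltW ltM).
  rewrite -[z](subrK c) addrC (le_trans (ler_normD _ _))// lerD2l.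
  exact: le_trans (mx_norm_le_enorm _) zcr.
pose d (z : 'rV[R]_n) := enorm (z - c).
rewrite /eball -[X in closed X]/(d @^-1` [set x | x <= r]).
by apply: preimage_closed => [z _|]; [exact: continuous_enormB|exact: closed_le].
Qed.

Lemma eball_center (c : 'rV[R]_n) (r : R) : 0 <= r -> eball c r c.
Proof.
move=> r0.
by rewrite /eball/= enorm_le// subrr -(scale0r 0) dotvZl mul0r exprn_ge0.
Qed.

End euclidean_space.

(** * Residual, distance and potential along the extragradient iterates *)

Section monotone_extragradient.
Context {R : realType} {n : nat} (L eta : R) (F : 'rV[R]_n -> 'rV[R]_n).
Hypotheses (L_ge0 : 0 <= L) (eta_gt0 : 0 < eta).
Hypotheses (F_mono : monotone_op F) (F_lip : lipschitz_op L F).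

Lemma dotv_lipschitz z z' :
  dotv (F z - F z') (F z - F z') <= L ^+ 2 * dotv (z - z') (z - z').
Proof.
rewrite -(sqr_enorm (z - z')) -exprMn -enorm_le ?F_lip//.
by rewrite mulr_ge0// enorm_ge0.
Qed.

(** With a, b, c the values of [F] at z, z - eta a, z - eta b, monotonicity gives <c - a, b> <= 0,
    and the Lipschitz bound gives |c - b|^2 <= (eta L)^2 |a - b|^2 <= |a - b|^2. Expanding the
    latter, |c|^2 <= |a|^2 + 2 <c - a, b>. *)
Lemma eg_step_residual z : eta * L <= 1 ->
  dotv (F (eg_step eta F z)) (F (eg_step eta F z)) <= dotv (F z) (F z).
Proof.
move=> etaL; rewrite /eg_step; set a := F z; set b := F (z - eta *: a).
set c := F _.
have := F_mono (z - eta *: b) z; rewrite -/a -/c addrAC subrr add0r.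
have := dotv_lipschitz (z - eta *: b) (z - eta *: a); rewrite -/b -/c.
rewrite opprB (addrC (z - _)) addrA subrK -scalerBr.
rewrite dotvNr !dotvZr dotvZl -mulrN pmulr_rge0// !mulrA.
have : (L ^+ 2 * eta * eta) * dotv (a - b) (a - b) <= 1 * dotv (a - b) (a - b).
  apply: ler_wpM2r; first exact: dotvv_ge0.
  have -> : L ^+ 2 * eta * eta = (eta * L) ^+ 2 by ring.
  by rewrite expr_le1// mulr_ge0// ltW.
rewrite !dotv_bilin (dotvC b a) (dotvC c b).
lra.
Qed.

(** Monotonicity at z - eta a yields <b, z - zs> >= eta <a, b>, so the squared distance changes by
    at most eta^2 (|a - b|^2 - |a|^2), where |a - b| <= eta L |a|. *)
Lemma eg_step_distance z zs : F zs = 0 ->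
  dotv (eg_step eta F z - zs) (eg_step eta F z - zs) <=
  dotv (z - zs) (z - zs)
  - eta ^+ 2 * (1 - (eta * L) ^+ 2) * dotv (F z) (F z).
Proof.
move=> Fzs; rewrite /eg_step; set a := F z; set b := F _.
have := F_mono (z - eta *: a) zs; rewrite -/b Fzs subr0.
(* Monotonicity is scaled by eta, and below the Lipschitz bound by eta^2, so that the expansions
   combine linearly. *)
rewrite -(pmulr_rge0 _ eta_gt0).
have := dotv_lipschitz z (z - eta *: a); rewrite -/a -/b subKr.
have e2 : 0 < eta ^+ 2 by rewrite exprn_gt0.
rewrite -(ler_pM2l e2) !dotv_bilin.
rewrite (dotvC b a) (dotvC b z) (dotvC b zs) (dotvC zs z).
lra.
Qed.

Lemma extragradient_potential z0 zs T : eta * L <= 1 -> F zs = 0 ->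
  let zT := extragradient eta F z0 T in
  dotv (zT - zs) (zT - zs)
    + T%:R * (eta ^+ 2 * (1 - (eta * L) ^+ 2) * dotv (F zT) (F zT))
  <= dotv (z0 - zs) (z0 - zs).
Proof.
move=> etaL Fzs; elim: T => [|T IH] /=; first by rewrite mul0r addr0.
apply: le_trans IH; set z := extragradient eta F z0 T.
rewrite -/(eg_step eta F z); set z' := eg_step eta F z.
have := eg_step_distance z Fzs; rewrite -/z'.
have k0 : 0 <= eta ^+ 2 * (1 - (eta * L) ^+ 2).
  by rewrite mulr_ge0 ?sqr_ge0// subr_ge0 expr_le1// mulr_ge0// ltW.
(* All T + 1 residual terms move back from z' to z: one is paid for by the decrease in distance, the
   other T belong to the induction hypothesis. *)
have : T.+1%:R * (eta ^+ 2 * (1 - (eta * L) ^+ 2) * dotv (F z') (F z'))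
    <= T.+1%:R * (eta ^+ 2 * (1 - (eta * L) ^+ 2) * dotv (F z) (F z)).
  by rewrite ler_wpM2l// ler_wpM2l// eg_step_residual.
rewrite -natr1 !mulrDl !mul1r.
set A := T%:R * _; set B := T%:R * _.
lra.
Qed.

Lemma extragradient_distance z0 zs T : eta * L <= 1 -> F zs = 0 ->
  enorm (extragradient eta F z0 T - zs) <= enorm (z0 - zs).
Proof.
move=> etaL Fzs; rewrite enorm_le ?enorm_ge0// sqr_enorm.
apply: le_trans (extragradient_potential z0 T etaL Fzs).
have q0 : 0 <= 1 - (eta * L) ^+ 2 by rewrite subr_ge0 expr_le1// mulr_ge0// ltW.
by rewrite lerDl mulr_ge0// mulr_ge0 ?dotvv_ge0// mulr_ge0// sqr_ge0.
Qed.

(* 8/7 exceeds (1 - 1/900)^(-1/2), and is small enough that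
   8/7 (1 + sqrt 2) <= 2 sqrt 2. *)
Lemma extragradient_rate (z0 zs : 'rV[R]_n) (D : R) T : eta * L <= 1 / 30 -> F zs = 0 ->
  0 <= D -> enorm (z0 - zs) <= D -> (0 < T)%N ->
  enorm (F (extragradient eta F z0 T)) <= 8 / 7 * (D / (eta * Num.sqrt T%:R)).
Proof.
move=> etaL Fzs D0; rewrite enorm_le// => z0D T0.
have TR : (0 : R) < T%:R by rewrite ltr0n.
have sT : 0 < Num.sqrt (T%:R : R) by rewrite sqrtr_gt0.
rewrite enorm_le; last first.
  by rewrite mulr_ge0 ?divr_ge0 ?mulr_ge0// ltW// ?mulr_gt0//.
rewrite !(exprMn, exprVn) sqr_sqrtr ?ler0n//.
rewrite mulrA ler_pdivlMr ?mulr_gt0 ?exprn_gt0//.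
have etaL1 : eta * L <= 1 by lra.
have := le_trans (extragradient_potential z0 T etaL1 Fzs) z0D.
set zT := extragradient _ _ _ _; set r := dotv (F zT) _.
move=> pot.
have r0 : 0 <= r by exact: dotvv_ge0.
have d0 : 0 <= dotv (zT - zs) (zT - zs) by exact: dotvv_ge0.
have : (eta * L) ^+ 2 <= (1 / 30) ^+ 2.
  by rewrite ler_pXn2r// nnegrE// ?mulr_ge0// ltW.
move=> q2.
(* This product bounds the nonlinear term of the potential; what remains is (8/7)^2 (1 - 1/900) >=
   1. *)
have : 0 <= (T%:R * eta ^+ 2 * r) * ((1 / 30) ^+ 2 - (eta * L) ^+ 2).
  by rewrite mulr_ge0 ?subr_ge0// !mulr_ge0// ?sqr_ge0// ltW.
have : 0 <= T%:R * eta ^+ 2 * r by rewrite !mulr_ge0// ?sqr_ge0// ltW.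
lra.
Qed.

End monotone_extragradient.

(** * First-order inequality for convex functions *)

Section convex_gradient.
Context {R : realType} {n : nat} (g : 'rV[R]_n -> R).

Lemma derive_dotv_grad x v : differentiable g x -> 'D_v g x = dotv (grad g x) v.
Proof.
move=> dg; rewrite deriveE// [in LHS](row_sum_delta v) linear_sum.
by apply: eq_bigr => i _; rewrite linearZ mxE deriveE//= mulrC.
Qed.

(** For 0 < h <= 1 convexity bounds the difference quotient by g y - g x. Only such h are
    controlled, hence the passage to the limit from the right. *)
Lemma convex_derive_le x y : convex_function [set: convex_lmodType 'rV[R]_n] g ->
  derivable g x (y - x) -> 'D_(y - x) g x <= g y - g x.
Proof.
move=> cg /cvg_ex[l dl].
have -> : 'D_(y - x) g x = l by exact: cvg_lim dl.
have {}dl := cvg_dnbhs_at_right dl.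
rewrite -(cvg_lim _ dl)//; apply: limr_le; first by apply/cvg_ex; exists l.
near=> h.
have h0 : 0 < h by near: h; exact: nbhs_right_gt.
have h1 : h <= 1 by near: h; exact: nbhs_right_le.
have gconv : g (h *: (y - x) + x) <= h * g y + (1 - h) * g x.
  have -> : h *: (y - x) + x = h *: y + (1 - h) *: x.
    by rewrite scalerBr scalerBl scale1r addrAC addrA.
  exact: (cg (Itv01 (ltW h0) h1) y x (in_setT _) (in_setT _)).
rewrite /= -[_ *: _]/(h^-1 * _) ler_pdivrMl//.
lra.
Unshelve. all: by end_near. Qed.

End convex_gradient.

(** * Duality gap of a convex-concave function *)

Section saddle_gap.
Context {R : realType} {nx ny n : nat} (e : (nx + ny)%N = n).
Implicit Types (x : 'rV[R]_nx) (y : 'rV[R]_ny).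

Lemma joinv_parts (z : 'rV[R]_n) : joinv e (xpart e z) (ypart e z) = z.
Proof. by case: n / e z => z; rewrite /joinv /xpart /ypart !castmx_id hsubmxK. Qed.

Lemma joinvB x y x' y' :
  joinv e x y - joinv e x' y' = joinv e (x - x') (y - y').
Proof.
by case: n / e; rewrite /joinv !castmx_id opp_row_mx add_row_mx.
Qed.

Lemma dotv_joinv x y x' y' :
  dotv (joinv e x y) (joinv e x' y') = dotv x x' + dotv y y'.
Proof.
case: n / e; rewrite /joinv !castmx_id /dotv big_split_ord/=.
by congr (_ + _); apply: eq_bigr => i _; rewrite ?row_mxEl ?row_mxEr.
Qed.

Variable f : 'rV[R]_nx * 'rV[R]_ny -> R.
Hypothesis f_diff : forall p, differentiable f p.

Lemma differentiable_section_l y x : differentiable (fun x => f (x, y)) x.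
Proof.
by apply: (@differentiable_comp _ _ _ _ (fun x => (x, y)) f).
Qed.

Lemma differentiable_section_r x y : differentiable (fun y => f (x, y)) y.
Proof.
by apply: (@differentiable_comp _ _ _ _ (fun y => (x, y)) f).
Qed.

(** Insert f (x, y) and apply the first-order inequality to f in x and to -f in y; the sign in the
    second block of [F] makes the two bounds add up to one inner product. *)
Lemma convex_concave_gap_le (F : 'rV[R]_n -> 'rV[R]_n) x y x' y' :
  convex_concave f -> saddle_operator e f F ->
  f (x, y') - f (x', y)
  <= dotv (F (joinv e x y)) (joinv e x y - joinv e x' y').
Proof.
move=> [cvx ccv] ->; rewrite joinvB dotv_joinv.
have dx := differentiable_section_l y x.
have dy := differentiable_section_r x y.
have := convex_derive_le (y := x') (cvx y) (diff_derivable dx).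
rewrite derive_dotv_grad//.
have := convex_derive_le (y := y') (ccv x) (diff_derivable (differentiableN dy)).
rewrite deriveN; last exact: diff_derivable.
rewrite derive_dotv_grad// !dotv_bilin.
lra.
Qed.

Lemma is_maximum_eball x c (r : R) : 0 <= r ->
  exists2 y, eball c r y & is_maximum [set f (x, y') | y' in eball c r] (f (x, y)).
Proof.
move=> r0; have [||//|y] := @compact_EVT_max _ R (fun y => f (x, y)) (eball c r).
- by exists c; exact: eball_center.
- exact: compact_eball.
- apply: continuous_subspaceT => y.
  exact/differentiable_continuous/differentiable_section_r.
rewrite inE => cy ymax; exists y => //; split; first by exists y.
by move=> _ [y' cy' <-]; apply: ymax; rewrite inE.
Qed.

Lemma is_minimum_eball y c (r : R) : 0 <= r ->
  exists2 x, eball c r x & is_minimum [set f (x', y) | x' in eball c r] (f (x, y)).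
Proof.
move=> r0; have [||//|x] := @compact_EVT_min _ R (fun x => f (x, y)) (eball c r).
- by exists c; exact: eball_center.
- exact: compact_eball.
- apply: continuous_subspaceT => x.
  exact/differentiable_continuous/differentiable_section_l.
rewrite inE => cx xmin; exists x => //; split; first by exists x.
by move=> _ [x' cx' <-]; apply: xmin; rewrite inE.
Qed.

End saddle_gap.

Unset Implicit Arguments.

Theorem theorem10 (R : realType) (n : nat) (L Lam D : R)
    (F : 'rV[R]_n -> 'rV[R]_n) (z0 zs : 'rV[R]_n) (eta : R)
    (L_gt0 : 0 < L) (Lam_gt0 : 0 < Lam) (D_gt0 : 0 < D)
    (F_mono : monotone_op F) (F_lip : lipschitz_op L F)
    (F_dlip : lipschitz_derivative Lam F)
    (F_zs : F zs = 0) (zs_z0 : enorm (zs - z0) <= D)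
    (eta_gt0 : 0 < eta)
    (eta_le : eta <= Num.min (5 / (Lam * D)) (1 / (30 * L))) :
  (forall T : nat, (1 <= T)%N ->
    enorm (F (extragradient eta F z0 T)) <= 2 * D / (eta * Num.sqrt T%:R)) /\
  (forall (nx ny : nat) (e : (nx + ny)%N = n)
      (f : 'rV[R]_nx * 'rV[R]_ny -> R),
    twice_differentiable f -> convex_concave f -> saddle_operator e f F ->
    forall T : nat, (1 <= T)%N ->
    let xT := xpart e (extragradient eta F z0 T) in
    let yT := ypart e (extragradient eta F z0 T) in
    exists M m : R,
      [/\ is_maximum [set f (xT, y') | y' in eball (ypart e zs) D] M,
          is_minimum [set f (x', yT) | x' in eball (xpart e zs) D] m
        & M - m <= 2 * Num.sqrt 2 * D ^+ 2 / (eta * Num.sqrt T%:R)]).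
Proof.
have [_ eta_leL] : eta <= 5 / (Lam * D) /\ eta <= 1 / (30 * L).
  by apply/andP; rewrite -le_min.
have etaL : eta * L <= 1 / 30.
  move: eta_leL; rewrite ler_pdivlMr ?mulr_gt0//.
  lra.
have z0D : enorm (z0 - zs) <= D by rewrite enormBC.
(* The constant 8/7 is kept for the gap: the residual constant gets multiplied by 1 + sqrt 2, so 2
   would be too large. *)
have rate T : (1 <= T)%N -> enorm (F (extragradient eta F z0 T)) <=
    8 / 7 * (D / (eta * Num.sqrt T%:R)).
  exact: (extragradient_rate (ltW L_gt0) eta_gt0 F_mono F_lip etaL F_zs (ltW D_gt0) z0D).
have Q_ge0 T : 0 <= D / (eta * Num.sqrt T%:R).
  by rewrite divr_ge0 ?mulr_ge0 ?sqrtr_ge0// ltW.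
split=> [T T1|nx ny e f [f_diff _] f_cc F_f T T1 xT yT].
  apply: le_trans (rate T T1) _; rewrite -(mulrA 2) ler_wpM2r//.
  lra.
have [y' y'D y'max] := is_maximum_eball f_diff xT (ypart e zs) (ltW D_gt0).
have [x' x'D x'min] := is_minimum_eball f_diff yT (xpart e zs) (ltW D_gt0).
exists (f (xT, y')), (f (x', yT)); split=> //.
apply: le_trans (convex_concave_gap_le f_diff xT yT x' y' f_cc F_f) _.
rewrite /xT /yT joinv_parts; set zT := extragradient eta F z0 T.
set r := enorm (F zT); pose s : R := Num.sqrt 2.
have s_ge0 : 0 <= s by exact: sqrtr_ge0.
have s2 : s ^+ 2 = 2 by rewrite sqr_sqrtr// ler0n.
(* 8/7 (1 + s) <= 2 s holds exactly when s >= 4/3. *)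
have s43 : 4 / 3 <= s by nra.
have zT_zs : enorm (zT - zs) <= D.
  apply: le_trans z0D.
  have etaL1 : eta * L <= 1 by lra.
  exact: (extragradient_distance (ltW L_gt0) eta_gt0 F_mono F_lip).
(* Each block contributes at most D^2 to the squared distance, whence the factor sqrt 2. *)
have zs_z' : enorm (zs - joinv e x' y') <= s * D.
  have sD_ge0 : 0 <= s * D by rewrite mulr_ge0// ltW.
  rewrite enormBC -{1}(joinv_parts e zs) joinvB enorm_le//.
  rewrite dotv_joinv exprMn s2.
  move: x'D y'D; rewrite /eball/= !enorm_le ?(ltW D_gt0)//.
  lra.
(* Splitting at zs and Cauchy-Schwarz bound the gap by r (1 + s) D. *)
have -> : zT - joinv e x' y' = (zT - zs) + (zs - joinv e x' y').
  by rewrite addrA subrK.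
rewrite dotvDr.
have r_ge0 : 0 <= r by exact: enorm_ge0.
have r_le := rate T T1.
have gap1 : dotv (F zT) (zT - zs) <= r * D.
  by apply: le_trans (dotv_le_enorm _ _) _; rewrite ler_wpM2l.
have gap2 : dotv (F zT) (zs - joinv e x' y') <= r * (s * D).
  by apply: le_trans (dotv_le_enorm _ _) _; rewrite ler_wpM2l.
have rD : r * ((1 + s) * D) <= 8 / 7 * (D / (eta * Num.sqrt T%:R)) * ((1 + s) * D).
  by rewrite ler_wpM2r// mulr_ge0 ?addr_ge0// ltW.
have -> : 2 * s * D ^+ 2 / (eta * Num.sqrt T%:R)
    = 2 * s * (D / (eta * Num.sqrt T%:R) * D) by ring.
have QD_ge0 : 0 <= D / (eta * Num.sqrt T%:R) * D by rewrite mulr_ge0// ltW.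
have : 8 / 7 * (1 + s) * (D / (eta * Num.sqrt T%:R) * D)
    <= 2 * s * (D / (eta * Num.sqrt T%:R) * D).
  rewrite ler_wpM2r//; lra.
lra.
Qed.
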